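(* Let $P,Q$ be probability measures on a measurable space, both absolutely continuous with respect to a measure $\lambda$, with Neyman-Pearson boundary $B:[0,1]\to[0,1]$. Let $g:[0,1]\to(-\infty,+\infty]$ be any upper bound for the Neyman-Pearson boundary, i.e. $B(\alpha)\le g(\alpha)$ for all $\alpha\in[0,1]$, and let $h(\alpha)=-\alpha+1$ be the line of ignorance. Then $g$ can be refined by the lower convex envelope $\mathrm{conv}(\min\{g,h\})$: for all $\alpha\in[0,1]$, $$B(\alpha)\le \mathrm{conv}(\min\{g,h\})(\alpha)\le g(\alpha).$$
   Context: The lower convex envelope $\mathrm{conv}(u)$ of a function $u$ on $[0,1]$ is the largest convex function on $[0,1]$ that is pointwise $\le u$. Tests: the hypotheses are $H_0$: $x$ is a sample from $Q$, and $H_1$: $x$ is a sample from $P$. A (possibly randomized) test is a measurable $\phi:\Omega\to[0,1]$, accepting $H_0$ with probability $\phi(x)$ and $H_1$ with probability $1-\phi(x)$; its false positive rate is $\alpha=\int(1-\phi)\,dQ$ and its false negative rate is $\beta=\int\phi\,dP$. The Neyman-Pearson region is the set of all $(\alpha,\beta)$ attained by tests, and the Neyman-Pearson boundary is given by $B(\alpha)=\min\{\beta:(\alpha,\beta)\text{ in the region}\}$, $\alpha\in[0,1]$. *)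

(* Defs.v *)
From HB Require Import structures.
From mathcomp Require Export all_boot all_order all_algebra.
From mathcomp Require Export all_classical all_reals all_analysis.

Set Implicit Arguments.
Unset Strict Implicit.
Unset Printing Implicit Defensive.

Import Order.TTheory GRing.Theory Num.Theory.
Import numFieldNormedType.Exports.

Local Open Scope classical_set_scope.
Local Open Scope ring_scope.

(* Functions on the unit interval are total functions on [R]; only their
   values on [`[0, 1]] are ever used. *)

Section neyman_pearson.
Context (d : measure_display) (T : measurableType d) (R : realType).

(* [phi x] is the probability of accepting H0 (the sample is from [Q]). *)
Definition is_test (phi : T -> R) : Prop :=
  measurable_fun [set: T] phi /\ forall x, 0 <= phi x <= 1.

Definition false_positive_rate (Q : probability T R) (phi : T -> R) : R :=
  \int[Q]_x (1 - phi x).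

Definition false_negative_rate (P : probability T R) (phi : T -> R) : R :=
  \int[P]_x phi x.

Definition NP_region (P Q : probability T R) : set (R * R) :=
  [set (false_positive_rate Q phi, false_negative_rate P phi)
    | phi in is_test].

(* The least element of the slice. It exists for every [a] in [`[0, 1]] by the
   Neyman-Pearson lemma, so the default [0] of [xget] plays no role there. *)
Definition NP_boundary (P Q : probability T R) (a : R) : R :=
  let slice := [set b | NP_region P Q (a, b)] in
  xget 0 (slice `&` lbound slice).

End neyman_pearson.

Section lower_convex_envelope.
Context (R : realType).

Definition convex_minorants (u : R -> \bar R) : set (R -> R) :=
  [set c | convex_function (`[0, 1] : set R^o) c /\
           forall a, a \in `[0, 1] -> ((c a)%:E <= u a)%E].

(* The largest convex minorant on [`[0, 1]]. It exists whenever [u] is bounded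
   below and its values at [0] and [1] are finite. It is unique on [`[0, 1]]
   but arbitrary outside. *)
Definition is_lower_convex_envelope (u : R -> \bar R) (c : R -> R) : Prop :=
  convex_minorants u c /\
  forall c', convex_minorants u c' -> forall a, a \in `[0, 1] -> c' a <= c a.

Definition lower_convex_envelope (u : R -> \bar R) : R -> R :=
  xget (fun=> 0) (is_lower_convex_envelope u).

Definition ignorance_line (a : R) : R := - a + 1.

End lower_convex_envelope.

(* Main.v *)
From HB Require Import structures.
Require Import Defs.
From mathcomp Require Import measurable_realfun.
From mathcomp Require Import ring lra.

Set Implicit Arguments.
Unset Strict Implicit.
Unset Printing Implicit Defensive.

Import Order.TTheory GRing.Theory Num.Theory.
Import numFieldNormedType.Exports.
Local Open Scope classical_set_scope.
Local Open Scope ring_scope.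

(** The Neyman-Pearson boundary [B] is itself one of the functions over which
    the envelope maximizes: it is convex, it lies below [g] by assumption, and
    it lies below the line of ignorance because the test that accepts H0 with
    constant probability [1 - a], blind to the sample, has error rates
    [(a, 1 - a)]. A largest convex minorant of [min g h] therefore dominates
    [B], and being a minorant of [min g h] it is below [g].

    Two existence facts have to back this up. First, [B] must really be a
    minimum: the least false negative rate at each level is attained
    ([neyman_pearson]), and only then does mixing two optimal tests, whose
    error rates mix linearly, give convexity ([NP_boundary_convex]). Second,
    the largest convex minorant exists ([lower_convex_envelopeP]): it is the
    pointwise supremum of all of them, which is finite because the minorants
    form a nonempty family bounded by [h], and convex because a supremum of
    convex functions is.

    For the Neyman-Pearson lemma, take the densities [p] and [1 - p] of [P] and
    [Q] with respect to [P + Q] ([exists_common_density]). Accepting H0 where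
    [p < s] and rejecting it where [p > s] minimizes pointwise, hence in the
    mean, the Lagrangian [(1 - s) * int phi dP - s * int phi dQ]
    ([threshold_test_le]). If [0 < a < 1], some [s] is a [(1 - a)]-quantile of
    [p] under [Q] ([exists_quantile]), and randomizing on [p = s] adjusts the
    level to exactly [a]; such an [s] is below 1, so at fixed level the
    Lagrangian orders tests by their false negative rate. At [a = 1] the test
    that never accepts H0 has no false negatives. At [a = 0] the multiplier
    degenerates to [s = 1], and the test accepting H0 where [p < 1] is optimal
    because every competitor at that level agrees with it almost everywhere on
    [p < 1] ([indic_density_lt1_le]). *)

(** * Tests and their error rates *)

Section tests.
Context (d : measure_display) (T : measurableType d) (R : realType).
Implicit Types (phi psi : T -> R).

Lemma test_bounded phi : is_test phi -> [bounded phi x | x in setT].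
Proof.
move=> [_ phi01]; exists 1; split => // M M1 x _ /=.
by have /andP[phi0 phi1] := phi01 x; rewrite ger0_norm// (le_trans phi1)// ltW.
Qed.

Lemma test_integrable (mu : {finite_measure set T -> \bar R}) phi :
  is_test phi -> mu.-integrable setT (EFin \o phi).
Proof.
move=> tphi; have [mphi _] := tphi.
apply: measurable_bounded_integrable => //; last exact: test_bounded.
by rewrite -ge0_fin_numE// fin_num_measure.
Qed.

Lemma test_mul_integrable (mu : {measure set T -> \bar R}) phi (f : T -> R) :
  is_test phi -> mu.-integrable setT (EFin \o f) ->
  mu.-integrable setT (EFin \o (fun x => phi x * f x)).
Proof.
move=> tphi intf; have [mphi _] := tphi.
apply: (eq_integrable _ ((EFin \o phi) \* (EFin \o f))%E) => //.
by apply: integrableMr => //; exact: test_bounded.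
Qed.

Lemma test_cst (a : R) : a \in `[0, 1] -> is_test (fun _ : T => a).
Proof. by rewrite in_itv/= => a01; split => //; exact: measurable_cst. Qed.

Lemma test_indic (A : set T) : measurable A -> is_test (\1_A : T -> R).
Proof.
move=> mA; split; first exact: measurable_indic.
by move=> x; rewrite indicE; case: (x \in A); rewrite !lexx ler01.
Qed.

Lemma test_conv (t : R) phi psi : t \in `[0, 1] -> is_test phi -> is_test psi ->
  is_test (fun x => t * phi x + (1 - t) * psi x).
Proof.
rewrite in_itv/= => t01 [mphi phi01] [mpsi psi01]; split.
  by apply: measurable_funD; apply: measurable_funM => //; exact: measurable_cst.
by move=> x; have := phi01 x; have := psi01 x; nra.
Qed.

Lemma Rintegral_conv (P : probability T R) (t : R) phi psi :
  is_test phi -> is_test psi ->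
  \int[P]_x (t * phi x + (1 - t) * psi x) =
  t * \int[P]_x phi x + (1 - t) * \int[P]_x psi x.
Proof.
move=> tphi tpsi; have iphi := test_integrable P tphi.
have ipsi := test_integrable P tpsi.
rewrite RintegralD// ?RintegralZl//.
- exact: (integrableZl measurableT t iphi).
- exact: (integrableZl measurableT (1 - t) ipsi).
Qed.

Lemma Rintegral_test_cst (P : probability T R) (a : R) : \int[P]_x a = a.
Proof. by rewrite Rintegral_cst//= probability_setT mulr1. Qed.

Lemma Rintegral_test_indic (P : probability T R) (A : set T) : measurable A ->
  \int[P]_x (\1_A x : R) = fine (P A).
Proof. by move=> mA; rewrite /Rintegral integral_indic// setIT. Qed.

Lemma false_positive_rateE (Q : probability T R) phi : is_test phi ->
  false_positive_rate Q phi = 1 - \int[Q]_x phi x.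
Proof.
move=> tphi; rewrite /false_positive_rate RintegralB//.
- by rewrite Rintegral_test_cst.
- by apply: (@test_integrable _ (cst 1)); apply: test_cst; rewrite in_itv/= ler01 lexx.
- exact: test_integrable.
Qed.

End tests.

(** * Densities with respect to the sum of the two measures *)

Section densities.
Context (d : measure_display) (T : measurableType d) (R : realType).
Variables P Q : probability T R.
Let mu := measure_add P Q.
Let mu_fin : fin_num_fun mu.
Proof. by move=> A mA; rewrite /mu measure_addE fin_numD !fin_num_measure. Qed.
HB.instance Definition _ := Measure.on mu.
HB.instance Definition _ := Measure_isFinite.Build d T R mu mu_fin.

(** The sum [P + Q] dominates both measures and is finite, and there the two
    densities add up to 1, so a single function [p] encodes the likelihood
    ratio [p / (1 - p)], including the value [+oo] at [p = 1]. *)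
Lemma exists_common_density :
  exists (mu : {finite_measure set T -> \bar R}) (p : T -> R),
    [/\ measurable_fun setT p, forall x, 0 <= p x,
        mu.-integrable setT (EFin \o p) &
        forall phi, is_test phi ->
          \int[P]_x phi x = \int[mu]_x (phi x * p x) /\
          \int[Q]_x phi x = \int[mu]_x (phi x * (1 - p x))].
Proof.
have Pmu : P `<< mu.
  apply/null_content_dominatesP => A mA; rewrite /= /mu measure_addE => PQA.
  by apply/eqP; rewrite eq_le measure_ge0 -PQA leeDl.
pose f := Radon_Nikodym_SigmaFinite.f P mu.
have f0 x : (0 <= f x)%E by exact: Radon_Nikodym_SigmaFinite.f_ge0.
have ffin x : f x \is a fin_num by exact: Radon_Nikodym_SigmaFinite.f_fin_num.
have pE : EFin \o (fine \o f) = f by apply/funext => x /=; rewrite fineK.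
have intf : mu.-integrable setT f by exact: Radon_Nikodym_SigmaFinite.f_integrable.
have mp : measurable_fun setT (fine \o f).
  by apply/measurable_EFinP; rewrite pE; exact: measurable_int intf.
exists mu, (fine \o f); split => //; first by move=> x; rewrite fine_ge0.
  by rewrite pE.
move=> phi tphi; have [mphi phi01] := tphi.
have phiP : \int[P]_x phi x = \int[mu]_x (phi x * (fine \o f) x).
  rewrite /Rintegral; congr fine.
  rewrite -(@Radon_Nikodym_SigmaFinite.change_of_variables _ _ _ P mu)//.
  - by apply: eq_integral => x _; rewrite EFinM/= fineK.
  - by move=> x; rewrite lee_fin; have /andP[] := phi01 x.
  - exact/measurable_EFinP.
split => //.
transitivity (\int[mu]_x (phi x - phi x * (fine \o f) x)); last first.
  by apply: eq_Rintegral => x _; rewrite mulrBr mulr1.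
have iphi := test_integrable mu tphi.
rewrite RintegralB//; last by apply: test_mul_integrable => //; rewrite pE.
have iP := test_integrable P tphi; have iQ := test_integrable Q tphi.
rewrite -phiP {2}/Rintegral integral_measure_add//.
rewrite fineD; [|exact: integrable_fin_num..].
by rewrite /Rintegral [RHS]addrC addKr.
Qed.

End densities.

(** * Quantiles *)

Section quantile.
Context (d : measure_display) (T : measurableType d) (R : realType).
Local Open Scope ereal_scope.

(** The infimum [s] of the points where the distribution function has reached
    [u] works: the right inequality is right continuity, and the left one is
    continuity from below of [Q] along the sublevel sets at [s - 1/(n+1)]. *)
Lemma exists_quantile (Q : probability T R) (X : {RV Q >-> R}) (u : R) :
  (0 < u < 1)%R -> exists s : R,
    Q [set x | X x < s]%R <= u%:E <= Q [set x | X x <= s]%R.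
Proof.
move=> /andP[u0 u1].
pose S : set R := [set s | u%:E <= cdf X s].
have cdfE r : cdf X r = Q [set x | X x <= r]%R.
  by rewrite /cdf/= /pushforward; congr (Q _); apply/seteqP; split => x /=; rewrite in_itv.
have S0 : S !=set0.
  apply/set0P/eqP => S0.
  suff : (1 <= u%:E)%E by rewrite lee_fin leNgt u1.
  apply: (cvge_le _ (cvg_cdfy1 X)); apply: nearW => r; rewrite ltW// ltNge.
  by apply/negP => Sr; have : S r by []; rewrite S0.
have Slb : has_lbound S.
  apply/not_existsP => noLB.
  suff : (u%:E <= 0)%E by rewrite lee_fin leNgt u0.
  apply: (cvge_ge _ (cvg_cdfNy0 X)); apply: nearW => r; rewrite leNgt.
  apply/negP => ur; apply: (noLB r) => s Ss; rewrite leNgt; apply/negP => sr.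
  by have := le_lt_trans (le_trans Ss (cdf_nondecreasing X (ltW sr))) ur; rewrite ltxx.
exists (inf S); apply/andP; split; last first.
  rewrite -cdfE; apply: (cvge_ge _ (@cdf_right_continuous _ _ _ _ X (inf S))).
  near=> r.
  have r0 : (0 < r - inf S)%R by rewrite subr_gt0; near: r; exact: nbhs_right_gt.
  have [s Ss] := inf_adherent r0 (conj S0 Slb); rewrite subrKC => /ltW sr.
  exact: le_trans Ss (cdf_nondecreasing X sr).
pose F n := [set x | X x <= inf S - n.+1%:R^-1]%R.
have -> : [set x | X x < inf S]%R = \bigcup_n F n.
  apply/seteqP; split => [x /= xs|x [n _ /= /le_lt_trans]]; last first.
    by apply; rewrite ltrBlDr ltrDl invr_gt0.
  have [k /ltW kx] := ltr_add_invr xs.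
  by exists k => //; rewrite /F/= lerBrDr.
have mF n : measurable (F n).
  rewrite -[F n]setTI; exact: measurable_fun_le.
apply: (cvge_le _ (nondecreasing_cvg_mu mF _ _)).
- apply: nearW => n /=; rewrite -cdfE ltW// ltNge; apply/negP => Sn.
  have := ge_inf Slb Sn; apply/negP; rewrite -ltNge ltrBlDr ltrDl.
  by rewrite invr_gt0.
- exact: bigcup_measurable.
- move=> n m nm; apply/subsetPset => x /= /le_trans; apply.
  by rewrite lerD2l lerN2 lef_pV2 ?posrE// ler_nat.
Unshelve. all: by end_near. Qed.

End quantile.

(** * The Neyman-Pearson lemma *)

Lemma exists_interpolation (R : realType) (a b u : R) : a <= u <= b ->
  exists2 t : R, t \in `[0, 1] & t * a + (1 - t) * b = u.
Proof.
move=> /andP[au ub]; have [ab|ab] := eqVneq a b; last first.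
  have ba : 0 < b - a by rewrite subr_gt0 lt_neqAle ab (le_trans au ub).
  exists ((b - u) / (b - a)); last by field; rewrite gt_eqF.
  rewrite in_itv/=; apply/andP; split; last by rewrite ler_pdivrMr// mul1r lerD2l lerN2.
  by apply: divr_ge0; [rewrite subr_ge0|exact: ltW].
by exists 1; rewrite ?in_itv/= ?lexx ?ler01//; lra.
Qed.

Lemma measurable_sublevel d (T : measurableType d) (R : realType) (f : T -> R) (s : R) :
  measurable_fun setT f -> measurable [set x | f x < s].
Proof.
move=> mf; rewrite (_ : [set x | _] = setT `&` f @^-1` `]-oo, s[%classic).
  exact: mf.
by rewrite setTI; apply/seteqP; split => x /=; rewrite in_itv.
Qed.

Section neyman_pearson_lemma.
Context (d : measure_display) (T : measurableType d) (R : realType).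
Variables (mu : {finite_measure set T -> \bar R}) (p : T -> R).
Hypothesis mp : measurable_fun setT p.
Hypothesis p_ge0 : forall x, 0 <= p x.
Hypothesis ip : mu.-integrable setT (EFin \o p).

Local Notation intP phi := (\int[mu]_x (phi x * p x)).
Local Notation intQ phi := (\int[mu]_x (phi x * (1 - p x))).

Lemma complement_integrable : mu.-integrable setT (EFin \o (fun x => 1 - p x)).
Proof.
have i1 : mu.-integrable setT (EFin \o cst (1 : R)).
  by apply: test_integrable; apply: test_cst; rewrite in_itv/= ler01 lexx.
exact: (integrableB measurableT i1 ip).
Qed.
Let iq := complement_integrable.

(** The Lagrangian is the integral of [phi * (p - s)], because
    [(1 - s) * p - s * (1 - p) = p - s]; its integrand is pointwise smallest
    when [phi] is 1 where [p - s] is negative and 0 where it is positive. *)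
Lemma threshold_test_le (s : R) (phi psi : T -> R) : is_test phi -> is_test psi ->
  (forall x, p x < s -> phi x = 1) -> (forall x, s < p x -> phi x = 0) ->
  (1 - s) * intP phi - s * intQ phi <= (1 - s) * intP psi - s * intQ psi.
Proof.
move=> tphi tpsi phi1 phi0.
have lagE f : is_test f ->
    \int[mu]_x (f x * (p x - s)) = (1 - s) * intP f - s * intQ f /\
    mu.-integrable setT (EFin \o (fun x => f x * (p x - s))).
  move=> tf; have iPf := test_mul_integrable tf ip; have iQf := test_mul_integrable tf iq.
  have iP' := integrableZl measurableT (1 - s) iPf.
  have iQ' := integrableZl measurableT s iQf.
  have E : (fun x => f x * (p x - s)) =
     (fun x => (1 - s) * (f x * p x) - s * (f x * (1 - p x))).
    by apply/funext => x; ring.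
  rewrite E; split; last exact: (integrableB measurableT iP' iQ').
  by rewrite RintegralB// !RintegralZl.
have [<- iphi] := lagE _ tphi; have [<- ipsi] := lagE _ tpsi.
apply: le_Rintegral => // x _.
have [_ /(_ x) psi01] := tpsi.
have [ps|ps|->] := ltgtP (p x) s; last by rewrite subrr !mulr0.
- by rewrite phi1// ler_nM2r ?subr_lt0//; case/andP: psi01.
- by rewrite phi0// ler_pM2r ?subr_gt0//; case/andP: psi01.
Qed.

(** The case [s = 1], where the Lagrangian no longer sees [P]. The difference
    of the two integrands [phi * (1 - p)] is nonnegative with zero integral, so
    it vanishes almost everywhere. Hence [psi = 1] almost everywhere on
    [p < 1], and elsewhere the indicator is 0. *)
Lemma indic_density_lt1_le (psi : T -> R) : is_test psi ->
  intQ psi = intQ (\1_[set x | p x < 1] : T -> R) ->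
  intP (\1_[set x | p x < 1] : T -> R) <= intP psi.
Proof.
set phi : T -> R := \1_ _ => tpsi eqQ.
have mA : measurable [set x | p x < 1] by exact: measurable_sublevel.
have tphi : is_test phi := test_indic R mA.
have phiE x : phi x = (p x < 1)%R%:R.
  by rewrite /phi indicE; congr ((nat_of_bool _)%:R); apply/idP/idP; rewrite inE.
pose h x := phi x * (1 - p x) - psi x * (1 - p x).
have iphi := test_mul_integrable tphi iq; have ipsi := test_mul_integrable tpsi iq.
have h0 x : 0 <= h x.
  have [_ /(_ x) /andP[psi0 psi1]] := tpsi.
  rewrite /h phiE; case: ltP => ?; rewrite ?mul1r ?mul0r; nra.
have ih : mu.-integrable setT (EFin \o h) := integrableB measurableT iphi ipsi.
have inth0 : (\int[mu]_x (h x)%:E = 0)%E.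
  have : \int[mu]_x h x = 0 by rewrite RintegralB// eqQ subrr.
  rewrite /Rintegral => h0'.
  by rewrite -[LHS]fineK ?integrable_fin_num// h0'.
have : ae_eq mu setT (EFin \o h) (cst 0%E).
  apply/ae_eq_integral_abs => //; first exact: measurable_int ih.
  by rewrite -inth0; apply: eq_integral => x _ /=; rewrite ger0_norm.
move=> h_ae; have ipphi := test_mul_integrable tphi ip.
have ippsi := test_mul_integrable tpsi ip.
rewrite /Rintegral fine_le ?integrable_fin_num//.
apply: ae_ge0_le_integral => //.
- by move=> x _; rewrite lee_fin phiE mulr_ge0.
- exact: measurable_int ipphi.
- by move=> x _; rewrite lee_fin mulr_ge0//; have [_ /(_ x) /andP[]] := tpsi.
- exact: measurable_int ippsi.
apply: filterS h_ae => x /(_ I) /= -[hx] _; rewrite lee_fin.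
have [_ /(_ x) /andP[psi0 psi1]] := tpsi.
move: hx; rewrite /h phiE; case: ltP => [p1|_ _]; last by rewrite mul0r mulr_ge0.
rewrite -mulrBl => /eqP; rewrite mulf_eq0 subr_eq0 [1 - p x == 0]subr_eq0.
by rewrite [1 == p x]eq_sym (lt_eqF p1) orbF => /eqP ->.
Qed.

End neyman_pearson_lemma.

Lemma neyman_pearson (d : measure_display) (T : measurableType d) (R : realType)
    (P Q : probability T R) (a : R) : a \in `[0, 1] ->
  exists phi : T -> R, [/\ is_test phi, false_positive_rate Q phi = a &
    forall psi, is_test psi -> false_positive_rate Q psi = a ->
      false_negative_rate P phi <= false_negative_rate P psi].
Proof.
rewrite in_itv/= => /andP[a0 a1].
have [mu [p [mp p0 ip dens]]] := exists_common_density P Q.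
have fprE phi : is_test phi -> false_positive_rate Q phi = a ->
    \int[Q]_x phi x = 1 - a.
  by move=> tphi; rewrite false_positive_rateE// => <-; rewrite subKr.
have mlt s : measurable [set x | p x < s] by exact: measurable_sublevel.
have mle s : measurable [set x | p x <= s].
  by rewrite -[X in measurable X]setTI; exact: measurable_fun_le.
(* The density [1 - p] of [Q] is nonpositive outside [p < 1]. *)
have Qlt1 : Q [set x | p x < 1] = 1%E.
  have tge : is_test (\1_(~` [set x | p x < 1]) : T -> R).
    exact/test_indic/measurableC.
  have [_] := dens _ tge; rewrite Rintegral_test_indic; last exact: measurableC.
  move=> Qge; have : fine (Q (~` [set x | p x < 1])) <= 0.
    rewrite Qge -oppr_ge0.
    set I := (X in - X); have -> : - I = (-1) * I by rewrite mulN1r.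
    rewrite -RintegralZl//; last exact: test_mul_integrable tge (complement_integrable ip).
    apply: Rintegral_ge0 => x _; rewrite indicE in_setC.
    case: (boolP (x \in _)) => [_|]; first by rewrite mul0r mulr0.
    by rewrite notin_setE/= => /negP; rewrite -leNgt => p1; rewrite mul1r mulN1r opprB subr_ge0.
  rewrite -[X in fine X](@fineK _ (Q _)) ?fin_num_measure//; last exact: measurableC.
  rewrite probability_setC//= -[Q [set x | p x < 1]]fineK ?fin_num_measure// -EFinB.
  rewrite /= subr_le0 => Q1; congr (_%:E); apply/eqP; rewrite eq_le Q1 andbT.
  by rewrite -lee_fin fineK ?fin_num_measure// probability_le1.
have [->|a1'] := eqVneq a 1.
  exists (fun=> 0); have t0 : is_test (fun _ : T => 0 : R).
    by apply: test_cst; rewrite in_itv/= ler01 lexx.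
  split => //; first by rewrite false_positive_rateE// Rintegral_test_cst subr0.
  move=> psi [_ psi01] _; rewrite /false_negative_rate Rintegral_test_cst.
  by apply: Rintegral_ge0 => x _; case/andP: (psi01 x).
have [a_eq0|a0'] := eqVneq a 0.
  have t1 := test_indic R (mlt 1).
  have fpr1 : false_positive_rate Q (\1_[set x | p x < 1] : T -> R) = a.
    by rewrite false_positive_rateE// Rintegral_test_indic// Qlt1/= subrr.
  exists (\1_[set x | p x < 1]); split => // psi tpsi psia.
  rewrite /false_negative_rate (dens _ t1).1 (dens _ tpsi).1.
  apply: indic_density_lt1_le => //.
  by rewrite -(dens _ tpsi).2 -(dens _ t1).2 (fprE _ tpsi) ?(fprE _ t1).
have u01 : 0 < 1 - a < 1.
  by rewrite subr_gt0 lt_neqAle a1' a1/= ltrBlDr ltrDl lt_neqAle eq_sym a0' a0.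
pose X : {RV Q >-> R} := mfun_Sub (mem_set mp).
have [s /= Qs] := exists_quantile X u01.
(* Otherwise [Q (p < s)] would be 1, too large for a [(1 - a)]-quantile. *)
have s1 : s < 1.
  rewrite ltNge; apply/negP => s1; have /andP[Qs1 _] := Qs.
  have : (Q [set x | (p x < 1)%R] <= (1 - a)%:E)%E.
    apply: le_trans Qs1; apply: le_measure; rewrite ?inE//.
    by move=> x /= /lt_le_trans; apply.
  by rewrite Qlt1 lee_fin leNgt; case/andP: u01 => _ ->.
(* Mixing the indicators of [p < s] and [p <= s] randomizes exactly on [p = s],
   with the level tuned between the two values bracketing [1 - a]. *)
have [t t01 tE] : exists2 t : R, t \in `[0, 1] &
    t * fine (Q [set x | p x < s]) + (1 - t) * fine (Q [set x | p x <= s]) = 1 - a.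
  by apply: exists_interpolation; rewrite -!lee_fin !fineK// fin_num_measure.
pose phi x := t * (\1_[set x | p x < s] x : R) + (1 - t) * (\1_[set x | p x <= s] x : R).
have tphi : is_test phi by apply: test_conv => //; exact: test_indic.
have intQphi : \int[Q]_x phi x = 1 - a.
  rewrite -tE -!Rintegral_test_indic//; apply: Rintegral_conv; exact: test_indic.
exists phi; split => //; first by rewrite false_positive_rateE// intQphi subKr.
move=> psi tpsi psia; rewrite /false_negative_rate.
have := @threshold_test_le _ _ _ mu p ip s _ _ tphi tpsi.
rewrite -(dens _ tphi).1 -(dens _ tphi).2 -(dens _ tpsi).1 -(dens _ tpsi).2.
rewrite intQphi (fprE _ tpsi psia) lerD2r ler_pM2l ?subr_gt0//; apply.
- move=> x ps; rewrite /phi !indicE !mem_set//=; last exact: ltW.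
  by rewrite !mulr1 subrKC.
- move=> x ps; rewrite /phi !indicE !memNset//= ?mulr0 ?addr0//; apply/negP.
    by rewrite -ltNge.
  by rewrite -leNgt ltW.
Qed.

(** * The Neyman-Pearson boundary *)

Section NP_boundary.
Context (d : measure_display) (T : measurableType d) (R : realType).
Variables (P Q : probability T R).

(** An optimal test at level [a] makes the set of least elements nonempty, so
    [xget] returns one of them and not its default. *)
Lemma NP_boundaryP (a : R) : a \in `[0, 1] ->
  NP_region P Q (a, NP_boundary P Q a) /\
  lbound [set b | NP_region P Q (a, b)] (NP_boundary P Q a).
Proof.
move=> a01; have [phi [tphi phia phi_min]] := neyman_pearson P Q a01.
rewrite /NP_boundary; set slice := [set b | _].
suff : (slice `&` lbound slice) (false_negative_rate P phi).
  by move=> h; exact: (xgetPex 0 (ex_intro _ _ h)).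
split; first by exists phi => //; rewrite phia.
by move=> b [psi tpsi [psia <-]]; exact: phi_min.
Qed.

Lemma NP_boundary_le_ignorance (a : R) : a \in `[0, 1] ->
  NP_boundary P Q a <= ignorance_line a.
Proof.
move=> a01; have [_] := NP_boundaryP a01; apply.
have t : is_test (fun _ : T => 1 - a).
  by apply: test_cst; move: a01; rewrite !in_itv/=; lra.
exists (fun=> 1 - a) => //; congr (_, _).
  by rewrite false_positive_rateE// Rintegral_test_cst subKr.
by rewrite /false_negative_rate Rintegral_test_cst addrC.
Qed.

(** Both error rates are affine in the test, so the mixture of tests optimal at
    [x] and [y] attains the corresponding point of the chord. *)
Lemma NP_boundary_convex :
  convex_function (`[0, 1]%classic : set R^o) (NP_boundary P Q).
Proof.
move=> t x y; rewrite !inE => x01 y01.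
have [[phi tphi [phix phiB]] _] := NP_boundaryP x01.
have [[psi tpsi [psiy psiB]] _] := NP_boundaryP y01.
pose s : R := t%:num.
have s01 : s \in `[0, 1] by rewrite in_itv/=; apply/andP; split; rewrite /s.
have tm := test_conv s01 tphi tpsi.
have E : conv t x y = s * x + (1 - s) * y by [].
have z01 : s * x + (1 - s) * y \in `[0, 1].
  by move: s01 x01 y01; rewrite /= !in_itv/=; nra.
rewrite E; have [_] := NP_boundaryP z01; apply.
exists (fun x => s * phi x + (1 - s) * psi x) => //; congr (_, _).
  rewrite false_positive_rateE// Rintegral_conv// -phix -psiy.
  by rewrite !false_positive_rateE//; ring.
by rewrite /false_negative_rate Rintegral_conv// -phiB -psiB.
Qed.

End NP_boundary.

(** * The lower convex envelope *)

Section lower_convex_envelope.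
Context (R : realType).

(** The pointwise supremum of all convex minorants is one of them; finiteness
    of [u] from above is what makes this supremum a real number. *)
Lemma lower_convex_envelopeP (u : R -> \bar R) : convex_minorants u !=set0 ->
  (forall a, a \in `[0, 1] -> (u a < +oo)%E) ->
  is_lower_convex_envelope u (lower_convex_envelope u).
Proof.
move=> [c0 mc0] uy.
pose vals a := [set c a | c in convex_minorants u].
pose c a := sup (vals a).
have valsn0 a : vals a !=set0 by exists (c0 a), c0.
have valsub a : a \in `[0, 1] -> has_ubound (vals a).
  move=> a01; exists (fine (u a)) => _ [c' [_ c'u] <-].
  have := c'u a a01; have := uy a a01.
  by case: (u a) => [r _|//|_]; rewrite ?lee_fin.
have lec c' a : convex_minorants u c' -> a \in `[0, 1] -> c' a <= c a.
  by move=> mc' a01; apply: ub_le_sup; [exact: valsub|exists c'].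
suff : is_lower_convex_envelope u c by move=> h; exact: (xgetPex _ (ex_intro _ _ h)).
split=> [|c' mc' a a01]; last exact: lec.
split=> [t x y|a a01].
  rewrite !inE => x01 y01.
  apply: ge_sup => // _ [c' mc' <-]; have [cvx _] := mc'.
  have := cvx t x y; rewrite !inE => /(_ x01 y01)/le_trans; apply.
  apply: lerD; apply: ler_wpM2l => //; [exact: lec| |exact: lec].
  by rewrite subr_ge0.
have := uy a a01; case Eu : (u a) => [r|//|].
- move=> _; rewrite lee_fin; apply: ge_sup => // _ [c' [_ c'u] <-].
  by have := c'u a a01; rewrite Eu lee_fin.
- by have [_ /(_ a a01)] := mc0; rewrite Eu.
Qed.

End lower_convex_envelope.

Theorem theorem2 (d : measure_display) (T : measurableType d) (R : realType)
    (lambda : {measure set T -> \bar R}) (P Q : probability T R)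
    (P_ac : P `<< lambda) (Q_ac : Q `<< lambda)
    (g : R -> \bar R)
    (g_gtNy : forall a : R, a \in `[0, 1] -> (-oo < g a)%E)
    (g_ub : forall a : R, a \in `[0, 1] -> ((NP_boundary P Q a)%:E <= g a)%E) :
  forall a : R, a \in `[0, 1] ->
    ((NP_boundary P Q a)%:E <=
       (lower_convex_envelope
          (fun t => Order.min (g t) (ignorance_line t)%:E) a)%:E <= g a)%E.
Proof.
set u := fun t => _.
have minorB : convex_minorants u (NP_boundary P Q).
  split; first exact: NP_boundary_convex.
  move=> a a01; rewrite le_min g_ub//= lee_fin.
  exact: NP_boundary_le_ignorance.
have [|[_ env_le_u] env_max] := @lower_convex_envelopeP _ u (ex_intro _ _ minorB).
  by move=> a _; rewrite /u gt_min ltry orbT.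
move=> a a01; rewrite lee_fin env_max//=.
by apply: le_trans (env_le_u a a01) _; rewrite ge_min lexx.
Qed.
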